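(* Let $n\ge2$ and $p>0$. If for every $Z\in\mathbb{M}_n$ there exist unitary matrices $U,V\in\mathbb{M}_n$ such that $$\left(\frac{|Z|^p+|Z^*|^p}{2}\right)^{1/p}\le U\,|\operatorname{Re}Z|\,U^*+V\,|\operatorname{Im}Z|\,V^*,$$ then necessarily $p\le2$.
   Context: $\mathbb{M}_n$ is the space of $n\times n$ complex matrices; $|Z|=(Z^*Z)^{1/2}$, $\operatorname{Re}Z=\frac{Z+Z^*}{2}$, $\operatorname{Im}Z=\frac{Z-Z^*}{2i}$. For Hermitian matrices, $X\le Y$ means $Y-X$ is positive semidefinite. *)

(* Defs.v *)
From mathcomp Require Import all_boot all_order all_algebra.
From mathcomp Require Import spectral sesquilinear complex.
From mathcomp Require Import reals exp.

Set Implicit Arguments.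
Unset Strict Implicit.
Unset Printing Implicit Defensive.
Import Order.TTheory GRing.Theory Num.Theory.

Local Open Scope ring_scope.
Local Open Scope sesquilinear_scope.
Local Open Scope complex_scope.

Section MatrixFunctions.
Variables (R : realType) (n : nat).
Implicit Types (X Y Z : 'M[R[i]]_n).

Definition psdmx X : Prop :=
  X \is hermsymmx /\ forall v : 'cV[R[i]]_n, 0 <= (v ^t* *m X *m v) 0 0.

Definition loewner_le X Y : Prop := psdmx (Y - X).

(* Real powers are given by functional calculus: if X = P^* diag(d) P with P
   unitary, then X^r = P^* diag(d^r) P. This is meaningful only for X positive
   semidefinite, where the d_i are nonnegative reals, and for r > 0, where
   0 `^ r = 0; the value at other arguments is junk. *)
Definition mxpowR X (r : R) : 'M[R[i]]_n :=
  invmx (spectralmx X)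
    *m diag_mx (map_mx (fun z : R[i] => (complex.Re z `^ r)%:C) (spectral_diag X))
    *m spectralmx X.

Definition mxabs Z : 'M[R[i]]_n := mxpowR (Z ^t* *m Z) 2^-1.

Definition mxRe Z : 'M[R[i]]_n := 2^-1 *: (Z + Z ^t*).

Definition mxIm Z : 'M[R[i]]_n := (2 * 'i%C)^-1 *: (Z - Z ^t*).

End MatrixFunctions.

(* Main.v *)
(** Write c = cos t and s = sin t with t small, let x = (c, s) and y = (c, -s)
    be unit vectors in the first two coordinates, and Z = x y^*. Then |Z| = y y^*
    and |Z^*| = x x^* are projections, hence equal to their powers, and their
    mean is diag(c^2, s^2): the left-hand side is diag(c^(2/p), s^(2/p)). On the
    other side |Re Z| = diag(c^2, s^2) and |Im Z| = diag(c s, c s). Taking traces,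
    c^(2/p) + s^(2/p) <= 1 + 2 c s, which fails for small s when p > 2 because
    s^(2/p) then dominates s. *)

Require Import Defs.
From mathcomp Require Import all_boot all_order all_algebra.
From mathcomp Require Import spectral sesquilinear complex.
From mathcomp Require Import reals exp.
From mathcomp Require Import ring lra.

Set Implicit Arguments.
Unset Strict Implicit.
Unset Printing Implicit Defensive.

Import Order.TTheory GRing.Theory Num.Theory.
Local Open Scope ring_scope.
Local Open Scope sesquilinear_scope.

(** * Functional calculus through eigenvectors *)

Lemma mulmx_adj_scale (C : numClosedFieldType) (n : nat) (k : C) (X : 'M[C]_n) :
  (k *: X) ^t* *m (k *: X) = (Num.conj k * k) *: (X ^t* *m X).
Proof.
have -> : (k *: X) ^t* = Num.conj k *: X ^t*.
  by apply/matrixP => i j; rewrite !mxE rmorphM.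
by rewrite -scalemxAl -scalemxAr scalerA.
Qed.

(** In the basis [S] the hypothesis reads (d_i - a) (S W)_ij = 0, so each entry of [S *m W] vanishes
    or sits where d_i = a, and there f(d_i) = f(a). Powers are thus computed from known
    eigenvectors, whatever diagonalization [spectralmx] picks. *)
Lemma spectral_calculus_eigen (C : numClosedFieldType) (n : nat) (f : C -> C)
    (X W : 'M[C]_n) (a : C) : X \is normalmx -> X *m W = a *: W ->
  invmx (spectralmx X) *m diag_mx (map_mx f (spectral_diag X)) *m spectralmx X
    *m W = f a *: W.
Proof.
move=> /orthomx_spectralP; set S := spectralmx X; set d := spectral_diag X.
move=> XE XW; have uS : S \in unitmx := unitarymx_unit (spectral_unitarymx X).
have dSW : diag_mx d *m (S *m W) = a *: (S *m W).
  by rewrite scalemxAr -XW XE !mulmxA mulmxV // mul1mx.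
rewrite -!mulmxA -[RHS](mulKmx uS) -[in RHS]scalemxAr; congr (_ *m _).
apply/matrixP => i j; move/matrixP/(_ i j): dSW.
rewrite !mul_diag_mx [X in X = _]mxE [X in _ = X]mxE => /eqP.
rewrite -subr_eq0 -mulrBl mulf_eq0 subr_eq0 [LHS]mxE [RHS]mxE [map_mx _ _ _ _]mxE.
by case/orP => /eqP -> //; rewrite !mulr0.
Qed.

Section MatrixPowers.
Variables (R : realType) (n : nat).
Implicit Types (X W P : 'M[R[i]]_n) (a r : R).

Lemma conj_real_complex (a : R) : Num.conj (a%:C)%C = (a%:C)%C.
Proof. exact: conjc_real. Qed.

Lemma hermsymmxP X : reflect (X ^t* = X) (X \is hermsymmx).
Proof.
apply: (iffP (is_hermitianmxP _ _ _)) => [{2}->|{1}<-];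
  by rewrite expr0 scale1r.
Qed.

Lemma mxpowR_eigen X W a r : X \is hermsymmx ->
  X *m W = (a%:C)%C *: W -> mxpowR X r *m W = ((a `^ r)%:C)%C *: W.
Proof.
move=> /hermitian_normalmx nX.
exact: (spectral_calculus_eigen (fun z : R[i] => ((complex.Re z `^ r)%:C)%C) nX).
Qed.

Lemma mxpowR_proj P r : P \is hermsymmx -> P *m P = P -> r != 0 ->
  mxpowR P r = P.
Proof.
move=> hP PP r0.
have h1 : mxpowR P r *m P = P.
  by rewrite (@mxpowR_eigen _ _ 1) ?powR1 ?scale1r.
have h0 : mxpowR P r *m (1%:M - P) = 0.
  rewrite (@mxpowR_eigen _ _ 0) ?powR0 ?scale0r //.
  by rewrite mulmxBr mulmx1 PP subrr.
by rewrite -[LHS]mulmx1 -(subrK P 1%:M) mulmxDr h0 h1 add0r.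
Qed.

Lemma psdmx_trace_ge0 X : psdmx X -> 0 <= \tr X.
Proof.
case=> _ X0; apply: sumr_ge0 => i _.
have := X0 (delta_mx i 0).
by rewrite trmx_delta map_delta_mx -rowE -colE !mxE.
Qed.

Lemma mxtrace_unitary_conj (U : 'M[R[i]]_n) X : U \is unitarymx ->
  \tr (U *m X *m U ^t*) = \tr X.
Proof.
move=> /unitarymxP /mulmx1C UU.
by rewrite mxtrace_mulC mulmxA UU mul1mx.
Qed.

End MatrixPowers.

(** * Real matrices viewed as complex ones *)

Section RealMatrices.
Variables (R : realType) (n : nat).
Implicit Types A B : 'M[R]_n.

Definition cplx A : 'M[R[i]]_n := map_mx (real_complex R) A.

Lemma cplx_adj A : (cplx A) ^t* = cplx A^T.
Proof. by apply/matrixP => i j; rewrite !mxE conj_real_complex. Qed.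

Lemma cplxD A B : cplx (A + B) = cplx A + cplx B.
Proof. exact: map_mxD. Qed.

Lemma cplxB A B : cplx (A - B) = cplx A - cplx B.
Proof. exact: map_mxB. Qed.

Lemma cplxZ (k : R) A : cplx (k *: A) = (k%:C)%C *: cplx A.
Proof. exact: map_mxZ. Qed.

Lemma cplxM A B : cplx (A *m B) = cplx A *m cplx B.
Proof. exact: map_mxM. Qed.

Lemma mxtrace_cplx A : \tr (cplx A) = ((\tr A)%:C)%C.
Proof. exact: trace_map_mx. Qed.

Lemma cplx_hermsym A : A^T = A -> cplx A \is hermsymmx.
Proof. by move=> AT; apply/hermsymmxP; rewrite cplx_adj AT. Qed.

End RealMatrices.

(** * Matrices supported on the upper left 2 x 2 block *)

Section Corner.
Variables (R : comPzRingType) (m : nat).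
Implicit Types a b c d : R.

(** Matrix units keep the product a 2 x 2 computation in every dimension. *)
Definition corner a b c d : 'M[R]_m.+2 :=
  let o0 := ord0 in let o1 := lift ord0 ord0 in
  a *: delta_mx o0 o0 + b *: delta_mx o0 o1
  + (c *: delta_mx o1 o0 + d *: delta_mx o1 o1).

Lemma trmx_corner a b c d : (corner a b c d)^T = corner a c b d.
Proof.
by rewrite /corner !(linearD, linearZ) /= !trmx_delta addrACA.
Qed.

Lemma cornerD a b c d a' b' c' d' :
  corner a b c d + corner a' b' c' d'
  = corner (a + a') (b + b') (c + c') (d + d').
Proof.
by rewrite /corner !scalerDl addrACA; congr (_ + _); rewrite addrACA.
Qed.

Lemma cornerZ k a b c d :
  k *: corner a b c d = corner (k * a) (k * b) (k * c) (k * d).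
Proof. by rewrite /corner !scalerDr !scalerA. Qed.

Lemma mulmx_corner a b c d a' b' c' d' :
  corner a b c d *m corner a' b' c' d'
  = corner (a * a' + b * c') (a * b' + b * d')
           (c * a' + d * c') (c * b' + d * d').
Proof.
rewrite /corner !(mulmxDl, mulmxDr).
rewrite -!(scalemxAl, scalemxAr) !scalerA !mul_delta_mx_cond /=.
rewrite !mulr1n !mulr0n !scaler0 !(addr0, add0r) !scalerDl.
by congr (_ + _); rewrite addrACA.
Qed.

Lemma mxtrace_corner a b c d : \tr (corner a b c d) = a + d.
Proof.
rewrite /mxtrace 2!big_ord_recl big1 => [|i _]; rewrite !mxE /=.
  by rewrite !(mulr1, mulr0, addr0, add0r).
by rewrite !(mulr1, mulr0, addr0, add0r).
Qed.

End Corner.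

Arguments corner {R m}.

Lemma mxpowR_corner (R : realType) m (a d r : R) : r != 0 ->
  mxpowR (cplx (@corner R m a 0 0 d)) r = cplx (corner (a `^ r) 0 0 (d `^ r)).
Proof.
move=> r0; set D := cplx _.
have hD : D \is hermsymmx by apply: cplx_hermsym; rewrite trmx_corner.
pose E0 := cplx (@corner R m 1 0 0 0); pose E1 := cplx (@corner R m 0 0 0 1).
have DE : D = (a%:C)%C *: E0 + (d%:C)%C *: E1.
  by rewrite -!cplxZ -cplxD !cornerZ cornerD !(mulr1, mulr0, addr0, add0r).
have D0 : D *m E0 = (a%:C)%C *: E0.
  rewrite -cplxM -cplxZ mulmx_corner cornerZ.
  by rewrite !(mulr1, mulr0, mul0r, addr0).
have D1 : D *m E1 = (d%:C)%C *: E1.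
  rewrite -cplxM -cplxZ mulmx_corner cornerZ.
  by rewrite !(mulr1, mulr0, mul0r, add0r).
(* The remaining coordinates span a kernel, which the power kills because [r] is nonzero. *)
have DN : D *m (1%:M - E0 - E1) = (0%:C)%C *: (1%:M - E0 - E1).
  by rewrite scale0r !mulmxBr mulmx1 D0 D1 {1}DE addrAC addrK subrr.
rewrite -[LHS]mulmx1 -[1%:M](subrK E0) -(subrK E1 (1%:M - E0)) 2!mulmxDr.
rewrite (mxpowR_eigen _ hD D0) (mxpowR_eigen _ hD D1).
rewrite (mxpowR_eigen _ hD DN) (powR0 r0) scale0r add0r addrC.
by rewrite -!cplxZ -cplxD !cornerZ cornerD !(mulr1, mulr0, addr0, add0r).
Qed.

(** * Absolute values of real matrices *)

Section RealAbs.
Variable R : realType.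

Lemma half_neq0 : 2^-1 != 0 :> R.
Proof. by rewrite invr_eq0 pnatr_eq0. Qed.

(** Here [A] is a partial isometry: neither the square root nor the [p]-th power changes the
    projection A^T A. *)
Lemma mxpowR_mxabs_proj (n : nat) (A P : 'M[R]_n) (p : R) :
  A^T *m A = P -> P *m P = P -> p != 0 ->
  mxpowR (mxabs (cplx A)) p = cplx P.
Proof.
move=> AP PP p0.
have hP : cplx P \is hermsymmx.
  by apply: cplx_hermsym; rewrite -AP trmx_mul trmxK.
have PP' : cplx P *m cplx P = cplx P by rewrite -cplxM PP.
by rewrite /mxabs cplx_adj -cplxM AP !(mxpowR_proj hP PP') // half_neq0.
Qed.

Lemma mxabs_corner (m : nat) (a d : R) :
  mxabs (cplx (@corner R m a 0 0 d)) = cplx (corner `|a| 0 0 `|d|).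
Proof.
rewrite /mxabs cplx_adj -cplxM trmx_corner mulmx_corner.
rewrite !(mulr0, mul0r, addr0, add0r) (mxpowR_corner _ _ _ half_neq0).
by rewrite -!expr2 !powR12_sqrt ?sqr_ge0 // !sqrtr_sqr.
Qed.

Lemma half_cplx : 2^-1 = ((2^-1 : R)%:C)%C.
Proof. by rewrite fmorphV rmorph_nat. Qed.

(** This turns the Gram matrix of [mxIm] of a real matrix into a real one, 1/4 B^T B with B = A -
    A^T. *)
Lemma sqr_norm_half_i :
  Num.conj (2 * 'i%C)^-1 * (2 * 'i%C)^-1 = (((2 ^- 2 : R))%:C)%C.
Proof.
have h (x : R[i]) : Num.conj x^-1 * x^-1 = (x * Num.conj x)^-1.
  by rewrite fmorphV invfM mulrC.
rewrite h fmorphV rmorphXn rmorph_nat rmorphM rmorph_nat; congr _^-1.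
have ii : 'i%C * Num.conj 'i%C = 1 :> R[i].
  apply/eqP; rewrite eq_complex /=; apply/andP; split; apply/eqP; ring.
by rewrite mulrACA ii mulr1 expr2.
Qed.

End RealAbs.

(** * The rank-one witness *)

Section Witness.
Variables (R : realType) (m : nat) (c s : R).
Hypotheses (c0 : 0 <= c) (s0 : 0 <= s) (cs1 : c ^+ 2 + s ^+ 2 = 1).

Let c2E : c ^+ 2 = 1 - s ^+ 2.
Proof. by rewrite -cs1 addrK. Qed.

Definition witness : 'M[R]_m.+2 :=
  corner (c ^+ 2) (- (c * s)) (c * s) (- s ^+ 2).

(** For e = 1 or -1, this is the orthogonal projection onto the line of (c, e s). *)
Definition witness_proj (e : R) : 'M[R]_m.+2 :=
  corner (c ^+ 2) (e * (c * s)) (e * (c * s)) (s ^+ 2).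

Lemma witness_proj_idem (e : R) : e ^+ 2 = 1 ->
  witness_proj e *m witness_proj e = witness_proj e.
Proof. by move=> e1; rewrite mulmx_corner; congr corner; ring: e1 c2E. Qed.

(** With Z = x y^T and x, y unit vectors, Z^T Z = y y^T; likewise Z Z^T = x x^T below. *)
Lemma trmx_mul_witness : witness^T *m witness = witness_proj (-1).
Proof. by rewrite trmx_corner mulmx_corner; congr corner; ring: c2E. Qed.

Lemma mul_trmx_witness : witness *m witness^T = witness_proj 1.
Proof. by rewrite trmx_corner mulmx_corner; congr corner; ring: c2E. Qed.

Lemma mxabs_witness (p : R) : p != 0 ->
  mxpowR (mxabs (cplx witness)) p = cplx (witness_proj (-1)).
Proof.
move=> p0; apply: mxpowR_mxabs_proj p0; first exact: trmx_mul_witness.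
by apply: witness_proj_idem; ring.
Qed.

Lemma mxabs_witness_adj (p : R) : p != 0 ->
  mxpowR (mxabs ((cplx witness) ^t*)) p = cplx (witness_proj 1).
Proof.
move=> p0; rewrite cplx_adj; apply: mxpowR_mxabs_proj p0.
  by rewrite trmxK mul_trmx_witness.
by apply: witness_proj_idem; ring.
Qed.

Lemma mxabs_Re_witness :
  mxabs (mxRe (cplx witness)) = cplx (corner (c ^+ 2) 0 0 (s ^+ 2)).
Proof.
rewrite /mxRe cplx_adj -cplxD trmx_corner cornerD half_cplx -cplxZ cornerZ.
(* The off-diagonal entries are opposite and cancel in the symmetric part. *)
rewrite [X in cplx X](_ : _ = corner (c ^+ 2) 0 0 (- s ^+ 2)).
  by rewrite mxabs_corner normrN !ger0_norm ?sqr_ge0.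
by congr corner; field.
Qed.

Lemma mxabs_Im_witness :
  mxabs (mxIm (cplx witness)) = cplx (corner (c * s) 0 0 (c * s)).
Proof.
rewrite /mxabs /mxIm cplx_adj -cplxB.
set B := witness - _; set k := (2 * _)^-1.
have -> : (k *: cplx B) ^t* *m (k *: cplx B) = cplx (2 ^- 2 *: (B^T *m B)).
  rewrite cplxZ cplxM -sqr_norm_half_i -/k -cplx_adj.
  exact: mulmx_adj_scale.
(* The skew part is 2 c s times a quarter turn, so B^T B is scalar on the block. *)
have -> : B = corner 0 (- 2 * (c * s)) (2 * (c * s)) 0.
  rewrite /B /witness trmx_corner -scaleN1r cornerZ cornerD.
  by congr corner; ring.
rewrite trmx_corner mulmx_corner cornerZ.
rewrite [X in cplx X](_ : _ = corner ((c * s) ^+ 2) 0 0 ((c * s) ^+ 2)).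
  rewrite (mxpowR_corner _ _ _ (half_neq0 R)).
  by rewrite !powR12_sqrt ?sqr_ge0 // !sqrtr_sqr ger0_norm ?mulr_ge0.
by congr corner; field.
Qed.

(** The trace is monotone for the Loewner order and blind to [U] and [V], so the matrix inequality
    becomes a scalar one. *)
Lemma witness_trace_le (p : R) (U V : 'M[R[i]]_m.+2) : 0 < p ->
  U \is unitarymx -> V \is unitarymx ->
  loewner_le
    (mxpowR (2^-1 *: (mxpowR (mxabs (cplx witness)) p
                      + mxpowR (mxabs ((cplx witness) ^t*)) p)) p^-1)
    (U *m mxabs (mxRe (cplx witness)) *m U ^t*
     + V *m mxabs (mxIm (cplx witness)) *m V ^t*) ->
  (c ^+ 2) `^ p^-1 + (s ^+ 2) `^ p^-1 <= 1 + 2 * (c * s).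
Proof.
move=> p0 Uu Vu /psdmx_trace_ge0; have pN0 : p != 0 by rewrite gt_eqF.
have pV0 : p^-1 != 0 by rewrite invr_eq0.
rewrite linearB linearD /= !mxtrace_unitary_conj // mxabs_Re_witness.
rewrite mxabs_Im_witness (mxabs_witness pN0) (mxabs_witness_adj pN0).
rewrite half_cplx -cplxD -cplxZ cornerD cornerZ.
(* The off-diagonal entries of the two projections cancel in their mean. *)
rewrite [X in mxpowR (cplx X)](_ : _ = corner (c ^+ 2) 0 0 (s ^+ 2)); last first.
  by congr corner; field.
rewrite (mxpowR_corner _ _ _ pV0) !mxtrace_cplx !mxtrace_corner.
rewrite cs1 -rmorphD -rmorphB /= lecR subr_ge0 => h.
by rewrite mulr_natl mulr2n.
Qed.

End Witness.

(** * Choice of [s] and contradiction *)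

Theorem theorem1p30 (R : realType) (n : nat) (p : R)
    (hn : (2 <= n)%N) (hp : 0 < p)
    (H : forall Z : 'M[R[i]]_n, exists U V : 'M[R[i]]_n,
       [/\ U \is unitarymx, V \is unitarymx &
         loewner_le
           (mxpowR (2^-1 *: (mxpowR (mxabs Z) p + mxpowR (mxabs (Z ^t*)) p)) p^-1)
           (U *m mxabs (mxRe Z) *m U ^t* + V *m mxabs (mxIm Z) *m V ^t*)]) :
  p <= 2.
Proof.
rewrite leNgt; apply/negP => p2.
case: n hn H => [|[|m]] // _ H.
have e0 : 0 < 1 - 2 / p by rewrite subr_gt0 ltr_pdivrMr ?mul1r.
(* Chosen so that s^(1 - 2/p) = 1/4, that is s^(2/p) = 4 s; any factor above 3 would do in the final
   estimate. *)
pose s : R := (4^-1) `^ (1 - 2 / p)^-1.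
have s0 : 0 < s by rewrite powR_gt0 // invr_gt0.
have s1 : s <= 1.
  have -> : 1 = 1 `^ (1 - 2 / p)^-1 :> R by rewrite powR1.
  by rewrite ge0_ler_powR ?nnegrE ?invr_ge0 ?ltW // invf_lt1 ?ltr1n.
have s4 : (s ^+ 2) `^ p^-1 = 4 * s.
  have se : s `^ (1 - 2 / p) = 4^-1.
    by rewrite -powRrM mulVf ?gt_eqF // powRr1 // invr_ge0.
  rewrite -powR_mulrn ?ltW // -powRrM.
  have : s = 4^-1 * s `^ (2 / p).
    by rewrite -se -powRD ?subrK ?powRr1 ?ltW // gt_eqF ?implybT.
  by lra.
pose c : R := Num.sqrt (1 - s ^+ 2).
have c2 : c ^+ 2 = 1 - s ^+ 2 by rewrite sqr_sqrtr // subr_ge0 expr_le1 // ltW.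
have c0 : 0 <= c := sqrtr_ge0 _.
have cs1 : c ^+ 2 + s ^+ 2 = 1 by rewrite c2 subrK.
have [U [V [Uu Vu]]] := H (cplx (witness m c s)).
move/(witness_trace_le c0 (ltW s0) cs1 hp Uu Vu).
rewrite s4 => h.
(* As c^2 is at most 1 and 1/p < 1, the power does not decrease it; c = 0 is treated apart because
   [ger1_powR] is applied to a positive base. *)
have cp : c ^+ 2 <= (c ^+ 2) `^ p^-1.
  have [->|cn0] := eqVneq c 0; first by rewrite expr0n powR_ge0.
  apply: ger1_powR; last by rewrite invf_le1 //; lra.
  by rewrite exprn_gt0 ?lt_def ?cn0 //= c2 gerBl sqr_ge0.
have c1 : c <= 1 by rewrite -(ler_pXn2r (n := 2)) ?nnegrE // expr1n c2 gerBl sqr_ge0.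
have cs : c * s <= s by rewrite ler_piMl // ltW.
have ss : s ^+ 2 <= s by rewrite expr2 ler_piMl // ltW.
(* The left side is at least 1 - s^2 + 4 s >= 1 + 3 s, the right side at most 1 + 2 s, and s > 0. *)
lra.
Qed.
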